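(* There exists a nonnegative $f \in P_{\mathbb{P}^2,8}$ such that, for all nonzero $g \in \Sigma_{\mathbb{P}^2,2}$, we have $fg \notin \Sigma_{\mathbb{P}^2,10}$.
   Context: For $i \in \mathbb{N}$, $P_{\mathbb{P}^2,2i}$ is the cone of homogeneous polynomials of degree $2i$ in $\mathbb{R}[x_0,x_1,x_2]$ that are nonnegative at every point of $\mathbb{R}^3$, and $\Sigma_{\mathbb{P}^2,2i}$ is the cone of finite sums of squares of homogeneous polynomials of degree $i$ in $\mathbb{R}[x_0,x_1,x_2]$. *)

(* Defs.v *)
From mathcomp Require Import all_boot all_order all_algebra.
From mathcomp Require Import mpoly reals.

Set Implicit Arguments.
Unset Strict Implicit.
Unset Printing Implicit Defensive.

Import Order.TTheory GRing.Theory Num.Theory.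
Local Open Scope ring_scope.

(* Both cones are indexed by the half-degree i.  The zero polynomial is
   homogeneous of every degree, so it belongs to each of them. *)

(* The cone P_{P^2,2i}. *)
Definition nonneg_form (R : realType) (i : nat) (f : {mpoly R[3]}) : Prop :=
  f \is (2 * i).-homog /\ forall x : 'I_3 -> R, 0 <= f.@[x].

(* The cone Sigma_{P^2,2i}. *)
Definition sos_form (R : realType) (i : nat) (f : {mpoly R[3]}) : Prop :=
  exists2 s : seq {mpoly R[3]},
    {in s, forall h, h \is i.-homog} & f = \sum_(h <- s) h ^+ 2.

(* Main.v *)
Require Import Defs.
From mathcomp Require Import all_boot all_order all_algebra.
From mathcomp Require Import mpoly reals.
From mathcomp Require Import ring lra zify.

Set Implicit Arguments.
Unset Strict Implicit.
Unset Printing Implicit Defensive.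

Import Order.TTheory GRing.Theory Num.Theory.
Local Open Scope ring_scope.

(** Write X, Y, Z for the squares of the three variables.  The octic is a sum
    of three arithmetic-geometric mean forms in X, Y, Z, hence nonnegative:
<<
      Y Z^3   + r^3 Y^2 Z^2 + X^3 Z - 3 r X Y Z^2
      Y^3 Z   + r^3 Y^2 Z^2 + X^3 Y - 3 r X Y^2 Z
      X^3 Y   + r^3 Y^2 Z^2 + X^3 Z - 3 r X^2 Y Z
>>
    Like the Motzkin form, each of them lives on a lattice triangle whose only
    further lattice point is its centroid, so it is not a sum of squares.  The
    three triangles form a fan with common vertex Y^2 Z^2, and the large value
    of r separates the scales of X : Y : Z at which each of them dominates the
    octic.  A quadratic form a X + b Y + c Z is comparable to one of its three
    terms away from a tropical line, and no tropical line meets all three of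
    these scales; so at one of them the multiplier behaves as the square of a
    single variable, and that cannot turn a Motzkin-like form into a sum of
    squares.

    One linear functional L on forms of degree 10 makes this rigorous for all
    multipliers at once.  It vanishes on monomials that are not squares and
    takes the value 21 ^ weight m on the square of the quintic monomial m.
    - L is nonnegative on squares of quintics ([moment_sqr_ge0]): its Gram
      matrix on the 21 quintic monomials has off-diagonal entries at most 1/21
      of the geometric mean of the corresponding diagonal entries, because the
      weight is midpoint convex with a margin ([weight_convex]).
    - L is negative on the octic times the square of a nonzero linear form
      ([octic_moment_sqr_lt0]): the products of distinct variables contribute
      nothing, and in each of L (f X), L (f Y), L (f Z) the central term
      -3 r of a different one of the three forms outweighs all others.
    Hence L (f g) < 0 for every nonzero sum g of squares of linear forms, while
    L is nonnegative on every sum of squares of quintics. *)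

(** Exponents are kept as triples of numbers, on which the finite checks below
    run by computation. *)
Definition expo : Type := (nat * nat * nat)%type.

Definition expo_add (p q : expo) : expo :=
  (p.1.1 + q.1.1, p.1.2 + q.1.2, p.2 + q.2)%N.

Definition mono (p : expo) : 'X_{1..3} :=
  [multinom nth 0%N [:: p.1.1; p.1.2; p.2] i | i < 3].

Definition expos (d : nat) : seq expo :=
  [seq ((i, j), (d - (i + j))%N) | i <- iota 0 d.+1, j <- iota 0 (d - i).+1].

Lemma mono_add (p q : expo) : mono (expo_add p q) = (mono p + mono q)%MM.
Proof. by apply/mnmP; case=> [[|[|[|//]]] lt_i]; rewrite mnmDE !mnmE. Qed.

Lemma mono_inj : injective mono.
Proof.
move=> [[i j] k] [[i' j'] k'] /mnmP eq_m.
have := eq_m (@Ordinal 3 0 isT); have := eq_m (@Ordinal 3 1 isT).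
by have := eq_m (@Ordinal 3 2 isT); rewrite !mnmE /= => -> -> ->.
Qed.

Lemma mono_surj (m : 'X_{1..3}) : exists2 p, p \in expos (mdeg m) & mono p = m.
Proof.
set o0 := @Ordinal 3 0 isT; set o1 := @Ordinal 3 1 isT; set o2 := @Ordinal 3 2 isT.
have deg_m : mdeg m = (m o0 + (m o1 + m o2))%N.
  rewrite mdegE !big_ord_recl big_ord0 addn0.
  by congr (_ + (_ + _))%N; congr (m _); apply: val_inj.
exists (m o0, m o1, m o2).
  apply/allpairsPdep; exists (m o0), (m o1); rewrite !mem_iota deg_m.
  split; [lia | lia | congr (_, _); lia].
apply/mnmP; case=> [[|[|[|//]]] lt_i]; rewrite !mnmE /=;
  by congr (m _); apply: val_inj.
Qed.

Lemma mdeg_mono (p : expo) : mdeg (mono p) = (p.1.1 + p.1.2 + p.2)%N.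
Proof. by rewrite mdegE !big_ord_recl big_ord0 !mnmE /= addn0 addnA. Qed.

Lemma uniq_expos (d : nat) : uniq (expos d).
Proof.
apply: allpairs_uniq_dep => [|i _|]; rewrite ?iota_uniq //.
by move=> [i j] [i' j'] _ _ /= [-> ->].
Qed.

Lemma homog_expansion (R : realType) (d : nat) (h : {mpoly R[3]}) :
  h \is d.-homog ->
  h = \sum_(p <- expos d) h@_(mono p) *: 'X_[mono p].
Proof.
move=> /dhomogP hh.
apply/mpolyP=> m; rewrite raddf_sum /=.
under eq_bigr => p _ do rewrite mcoeffZ mcoeffX.
have [p0 p0_in mono_p0] := mono_surj m.
have [hm0|hm] := eqVneq h@_m 0.
  rewrite hm0 big1 // => p _; case: eqP => [->|]; by rewrite ?hm0 ?mul0r ?mulr0.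
have deg_m : mdeg m = d by apply: hh; rewrite mcoeff_msupp.
rewrite deg_m in p0_in; rewrite (bigD1_seq p0) ?uniq_expos //=.
rewrite mono_p0 eqxx mulr1.
rewrite big1 ?addr0 // => p neq_p; rewrite -mono_p0 (inj_eq mono_inj).
by rewrite (negPf neq_p) mulr0.
Qed.

(** * The separating functional *)

(** Row i, column j holds the weight of the exponent (i, j, 5 - i - j).  The
    table is symmetric in the last two variables, as the octic is.  The entries
    form an integer point of the cone cut out by [weight_convex] and by the
    demand that, for every variable x_i, the product of x_i^2 with the central
    term of one of the three mean forms has a larger power of 21 than its
    product with any positive term. *)
Definition weight_rows : seq (seq nat) :=
  [:: [:: 78; 30; 0; 0; 30; 78];
      [:: 60; 21; 0; 21; 60];
      [:: 44; 14; 14; 44];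
      [:: 30; 21; 30];
      [:: 30; 30];
      [:: 44]]%N.

Definition weight (p : expo) : nat := nth 0%N (nth [::] weight_rows p.1.1) p.1.2.

(** If m^2 = p q for distinct quintic monomials p and q, the value of L at p q
    is at most 1/21 of the geometric mean of its values at p^2 and q^2. *)
Lemma weight_convex :
  all (fun m => all (fun p => all (fun q =>
    [|| p == q, expo_add p q != expo_add m m |
      2 * (weight m).+1 <= weight p + weight q]%N)
    (expos 5)) (expos 5)) (expos 5).
Proof. by vm_compute. Qed.

Definition moment (R : realType) (s : R) (p : {mpoly R[3]}) : R :=
  \sum_(m <- expos 5) s ^+ weight m * p@_(mono (expo_add m m)).

Lemma moment_comb (R : realType) (s : R) (I : Type) (u : seq I) (c : I -> R)
    (p : I -> {mpoly R[3]}) :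
  moment s (\sum_(i <- u) c i *: p i) = \sum_(i <- u) c i * moment s (p i).
Proof.
under [RHS]eq_bigr => i _ do rewrite mulr_sumr.
rewrite exchange_big; apply: eq_bigr => m _ /=.
rewrite raddf_sum mulr_sumr; apply: eq_bigr => i _ /=.
by rewrite mcoeffZ mulrCA.
Qed.

Lemma moment_mono_even (R : realType) (s : R) (m : expo) :
  m \in expos 5 -> moment s 'X_[mono (expo_add m m)] = s ^+ weight m.
Proof.
move=> m_in; rewrite /moment (bigD1_seq m) ?uniq_expos //= mcoeffX eqxx mulr1.
rewrite big1 ?addr0 // => -[[i' j'] k'] neq.
rewrite mcoeffX (inj_eq mono_inj).
case: eqP => [|_]; last by rewrite mulr0.
case: m neq {m_in} => [[i j] k] /eqP neq [ei ej ek].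
case: neq; congr (_, _, _); lia.
Qed.

Lemma moment_mono_odd (R : realType) (s : R) (n : expo) :
  {in expos 5, forall m, n != expo_add m m} -> moment s 'X_[mono n] = 0.
Proof.
move=> odd_n; rewrite /moment big1_seq // => m /andP[_ m_in].
by rewrite mcoeffX (inj_eq mono_inj) (negPf (odd_n m m_in)) mulr0.
Qed.

(** Expansion of the quadratic form h |-> L (f h^2); f = 1 gives the Gram
    matrix of L, and f the octic gives its localization. *)
Lemma moment_sqr (R : realType) (s : R) (f h : {mpoly R[3]}) (d : nat) :
  h \is d.-homog ->
  moment s (f * h ^+ 2) =
  \sum_(p <- expos d) \sum_(q <- expos d)
     h@_(mono p) * h@_(mono q) * moment s (f * 'X_[mono (expo_add p q)]).
Proof.
move=> /homog_expansion {1}->; rewrite expr2 mulr_suml mulr_sumr.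
transitivity (moment s (\sum_(p <- expos d) h@_(mono p) *:
   \sum_(q <- expos d) h@_(mono q) *: (f * 'X_[mono (expo_add p q)]))).
  congr (moment s _); apply: eq_bigr => p _.
  rewrite -scalerAl -scalerAr mulr_sumr mulr_sumr; congr (_ *: _).
  apply: eq_bigr => q _.
  by rewrite -!scalerAr mono_add mpolyXD.
rewrite moment_comb; apply: eq_bigr => p _.
rewrite moment_comb mulr_sumr; apply: eq_bigr => q _.
by rewrite mulrA.
Qed.

(** The lower bound B p q >= [p = q] A p - (A p + A q) / (2 n), with n the size
    of u, holds on and off the diagonal, and its right-hand side sums to 0. *)
Lemma sum_diag_dominant_ge0 (R : realType) (I : eqType) (u : seq I)
    (A : I -> R) (B : I -> I -> R) :
  uniq u -> {in u, forall p, B p p = A p} ->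
  {in u &, forall p q, p != q -> - (A p + A q) <= (2 * size u)%:R * B p q} ->
  {in u, forall p, 0 <= A p} ->
  0 <= \sum_(p <- u) \sum_(q <- u) B p q.
Proof.
move=> uniq_u diagB offB A_ge0.
case: (posnP (size u)) => [/size0nil -> | n_gt0]; first by rewrite big_nil.
set n := size u in offB n_gt0 *; set c : R := ((2 * n)%:R)^-1.
have n2_gt0 : 0 < (2 * n)%:R :> R by rewrite ltr0n muln_gt0.
have c_gt0 : 0 < c by rewrite invr_gt0.
have lowB p q : p \in u -> q \in u ->
    (p == q)%:R * A p - c * (A p + A q) <= B p q.
  move=> p_in q_in; case: eqVneq => [<-|neq].
    rewrite diagB // mul1r gerBl mulr_ge0 ?addr_ge0 ?A_ge0 ?ltW //.
  rewrite mul0r sub0r -mulrN /c mulrC ler_pdivrMr // mulrC.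
  exact: offB.
suff sum0 : 0 = \sum_(p <- u) \sum_(q <- u)
    ((p == q)%:R * A p - c * (A p + A q)) :> R.
  rewrite [leLHS]sum0 big_seq [leRHS]big_seq; apply: ler_sum => p p_in.
  rewrite big_seq [leRHS]big_seq.
  by apply: ler_sum => q q_in; apply: lowB.
set S := \sum_(p <- u) A p.
transitivity (\sum_(p <- u) (A p - c * (n%:R * A p + S))).
  rewrite sumrB -mulr_sumr big_split /= -mulr_sumr -/S.
  rewrite big_const_seq count_predT iter_addr_0 -/n -mulr_natl.
  rewrite /c natrM; field; rewrite ?pnatr_eq0 -?lt0n //.
rewrite big_seq [RHS]big_seq; apply: eq_bigr => p p_in.
rewrite sumrB -mulr_sumr big_split /= -/S; congr (_ - c * (_ + _)).
  rewrite (bigD1_seq p) //= eqxx mul1r big1 ?addr0 // => q.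
  by rewrite eq_sym => /negPf ->; rewrite mul0r.
by rewrite big_const_seq count_predT iter_addr_0 mulr_natl.
Qed.

Lemma weighted_AGM (R : realFieldType) (a b w u v : R) :
  0 <= w -> 0 <= u -> 0 <= v -> w ^+ 2 <= u * v ->
  - (u * a ^+ 2 + v * b ^+ 2) <= 2 * (w * (a * b)).
Proof.
move=> w_ge0 u_ge0 v_ge0 le_w.
have sum_ge0 : 0 <= u * a ^+ 2 + v * b ^+ 2.
  by rewrite addr_ge0 // mulr_ge0 ?sqr_ge0.
suff : `|2 * (w * (a * b))| <= u * a ^+ 2 + v * b ^+ 2 by rewrite ler_norml => /andP[].
rewrite -ler_sqr ?nnegrE // real_normK ?num_real //.
have sqr_le : w ^+ 2 * (a * b) ^+ 2 <= (u * v) * (a * b) ^+ 2.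
  by rewrite ler_wpM2r ?sqr_ge0.
have := sqr_ge0 (u * a ^+ 2 - v * b ^+ 2).
nra.
Qed.

Lemma moment_sqr_ge0 (R : realType) (h : {mpoly R[3]}) :
  h \is 5.-homog -> 0 <= moment 21 (h ^+ 2).
Proof.
move=> hh; rewrite -[h ^+ 2]mul1r (moment_sqr _ _ hh).
pose A p : R := 21 ^+ weight p * h@_(mono p) ^+ 2.
have A_ge0 p : 0 <= A p by rewrite mulr_ge0 ?sqr_ge0 ?exprn_ge0 ?ler0n.
apply: (@sum_diag_dominant_ge0 _ _ (expos 5) A (fun p q => h@_(mono p) *
  h@_(mono q) * moment 21 (1 * 'X_[mono (expo_add p q)]))) => [|p p_in|p q p_in q_in neq|p _].
- exact: uniq_expos.
- by rewrite mul1r moment_mono_even // /A; ring.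
- rewrite mul1r; case: (boolP (has (fun m => expo_add p q == expo_add m m) (expos 5))).
    move=> /hasP[m m_in /eqP e_pq]; rewrite e_pq moment_mono_even //.
    have /allP/(_ m m_in)/allP/(_ p p_in)/allP/(_ q q_in) := weight_convex.
    rewrite (negPf neq) e_pq eqxx /= => le_w.
    have -> : (2 * size (expos 5))%:R * (h@_(mono p) * h@_(mono q) * 21 ^+ weight m)
            = 2 * (21 ^+ (weight m).+1 * (h@_(mono p) * h@_(mono q))) :> R.
      rewrite exprS; have -> : size (expos 5) = 21%N by [].
      rewrite natrM; ring.
    apply: weighted_AGM; rewrite ?exprn_ge0 //.
    by rewrite -exprD -exprM mulnC ler_weXn2l // (ler_nat R 1 21).
  move=> /hasPn odd_pq; rewrite moment_mono_odd // !mulr0 oppr_le0.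
  by rewrite addr_ge0.
exact: A_ge0.
Qed.

(** * The octic *)

(** The sum of the three mean forms, as coefficients and exponents in X, Y, Z;
    the vertices shared by several triangles are collected. *)
Definition octic_terms (R : realType) (r : R) : seq (R * expo) :=
  [:: (1, (0, 1, 3)%N); (1, (0, 3, 1)%N); (3 * r ^+ 3, (0, 2, 2)%N);
      (2, (3, 0, 1)%N); (2, (3, 1, 0)%N);
      (- 3 * r, (1, 1, 2)%N); (- 3 * r, (1, 2, 1)%N); (- 3 * r, (2, 1, 1)%N)].

Definition octic (R : realType) (r : R) : {mpoly R[3]} :=
  \sum_(c <- octic_terms r) c.1 *: 'X_[mono (expo_add c.2 c.2)].

(** The mean inequality without cube roots: (a + b + c)^3 - 27 a b c is a
    combination of the a (b - c)^2 and (a + b + c) (a - b)^2. *)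
Lemma AGM3 (R : realFieldType) (a b c m : R) :
  0 <= a -> 0 <= b -> 0 <= c -> 0 <= m -> a * b * c = m ^+ 3 ->
  3 * m <= a + b + c.
Proof.
move=> a_ge0 b_ge0 c_ge0 m_ge0 abc.
have sum_ge0 : 0 <= a + b + c by rewrite !addr_ge0.
have m3_ge0 : 0 <= 3 * m by rewrite mulr_ge0.
rewrite -(@ler_pXn2r _ 3) ?nnegrE // exprMn -abc.
have := mulr_ge0 (addr_ge0 (addr_ge0 (mulr_ge0 (ler0n R 1) a_ge0) b_ge0) c_ge0)
  (addr_ge0 (addr_ge0 (sqr_ge0 (a - b)) (sqr_ge0 (b - c))) (sqr_ge0 (c - a))).
have := mulr_ge0 a_ge0 (sqr_ge0 (b - c)).
have := mulr_ge0 b_ge0 (sqr_ge0 (c - a)).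
have := mulr_ge0 c_ge0 (sqr_ge0 (a - b)).
lra.
Qed.

Lemma octic_quartic_ge0 (R : realFieldType) (r x y z : R) :
  0 <= r -> 0 <= x -> 0 <= y -> 0 <= z ->
  0 <= (y * z ^+ 3 + r ^+ 3 * y ^+ 2 * z ^+ 2 + x ^+ 3 * z
          - 3 * (r * x * y * z ^+ 2))
     + (y ^+ 3 * z + r ^+ 3 * y ^+ 2 * z ^+ 2 + x ^+ 3 * y
          - 3 * (r * x * y ^+ 2 * z))
     + (r ^+ 3 * y ^+ 2 * z ^+ 2 + x ^+ 3 * y + x ^+ 3 * z
          - 3 * (r * x ^+ 2 * y * z)).
Proof.
move=> r_ge0 x_ge0 y_ge0 z_ge0.
by apply: addr_ge0; first apply: addr_ge0; rewrite subr_ge0; apply: AGM3;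
  rewrite ?(addr_ge0, mulr_ge0, exprn_ge0) //; ring.
Qed.

Lemma octic_nonneg (R : realType) (r : R) : 0 <= r -> nonneg_form 4 (octic r).
Proof.
move=> r_ge0; split.
  rewrite /octic big_seq; apply: rpred_sum => c c_in; apply: rpredZ.
  rewrite dhomogX [X in X == _](mdeg_mono _).
  have : all (fun c : R * expo => c.2.1.1 + c.2.1.2 + c.2.2 == 4)%N (octic_terms r) by [].
  by move=> /allP/(_ c c_in) /=; lia.
move=> x; set o0 := @Ordinal 3 0 isT; set o1 := @Ordinal 3 1 isT.
set o2 := @Ordinal 3 2 isT.
have eval_mono p : ('X_[mono p] : {mpoly R[3]}).@[x] =
    x o0 ^+ p.1.1 * x o1 ^+ p.1.2 * x o2 ^+ p.2.
  rewrite mevalX !big_ord_recl big_ord0 !mnmE /= mulr1 mulrA.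
  by congr (x _ ^+ _ * x _ ^+ _ * x _ ^+ _); apply: val_inj.
rewrite /octic /octic_terms raddf_sum /=.
under eq_bigr => c _ do rewrite mevalZ eval_mono.
rewrite !big_cons big_nil /=.
set X := x o0 ^+ 2; set Y := x o1 ^+ 2; set Z := x o2 ^+ 2.
have := @octic_quartic_ge0 _ r X Y Z r_ge0 (sqr_ge0 _) (sqr_ge0 _) (sqr_ge0 _).
congr (_ <= _); rewrite /X /Y /Z; ring.
Qed.

Lemma octic_moment_mono (R : realType) (r s : R) (n : expo) :
  moment s (octic r * 'X_[mono n]) =
  \sum_(c <- octic_terms r)
     c.1 * moment s 'X_[mono (expo_add (expo_add c.2 c.2) n)].
Proof.
rewrite /octic mulr_suml -moment_comb; congr (moment s _).
by apply: eq_bigr => c _; rewrite -scalerAl -mpolyXD -mono_add.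
Qed.

(** All exponents of the octic are even, so distinct variables p and q leave an
    odd exponent in every term. *)
Lemma octic_moment_offdiag (R : realType) (r s : R) :
  {in expos 1 &, forall p q, p != q ->
     moment s (octic r * 'X_[mono (expo_add p q)]) = 0}.
Proof.
move=> p q p_in q_in neq; rewrite octic_moment_mono big1_seq // => c /andP[_ c_in].
rewrite moment_mono_odd ?mulr0 // => m m_in.
have : all (fun c : R * expo => all (fun m => all (fun p => all (fun q =>
    (p == q) || (expo_add (expo_add c.2 c.2) (expo_add p q) != expo_add m m))
  (expos 1)) (expos 1)) (expos 5)) (octic_terms r) by vm_compute.
move=> /allP/(_ c c_in)/allP/(_ m m_in)/allP/(_ p p_in)/allP/(_ q q_in).
by rewrite (negPf neq).
Qed.

Lemma expo_addACA (p q : expo) :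
  expo_add (expo_add p p) (expo_add q q) = expo_add (expo_add p q) (expo_add p q).
Proof. by congr (_, _, _) => /=; lia. Qed.

(** In each of the three sums the positive terms have powers at most 21^30 with
    total coefficient 9, against -3 * 21^31 from one central term. *)
Lemma octic_moment_diag (R : realType) :
  {in expos 1, forall p,
     moment 21 (octic (21 ^+ 10) * 'X_[mono (expo_add p p)]) < 0 :> R}.
Proof.
move=> p p_in; rewrite octic_moment_mono.
under eq_bigr => c _ do rewrite expo_addACA.
rewrite !big_cons big_nil /=.
move: p_in; rewrite !inE => /or3P[] /eqP -> /=.
all: rewrite !moment_mono_even //= /weight /=.
(* After 21 is generalized to s, the goals are linear in the powers of s; the
   factor 20 <= s is the numerical information that survives. *)
all: have s_ge1 : 1 <= 21 :> R by rewrite (ler_nat R 1 21).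
all: have : 20 * 21 ^+ 30 <= 21 ^+ 31 :> R
  by rewrite [leRHS]exprS; apply: ler_wpM2r; rewrite ?exprn_ge0 ?ler0n ?(ler_nat R 20 21).
all: have : 21 ^+ 21 <= 21 ^+ 30 :> R by rewrite ler_weXn2l.
all: have : 1 <= 21 ^+ 30 :> R by rewrite exprn_ege1.
all: have : 0 <= 21 ^+ 10 :> R by rewrite exprn_ge0 ?ler0n.
all: have : 0 <= 21 ^+ 24 :> R by rewrite exprn_ge0 ?ler0n.
all: move: (21 : R) => s; lra.
Qed.

Lemma octic_moment_sqr_lt0 (R : realType) (l : {mpoly R[3]}) :
  l \is 1.-homog -> l != 0 -> moment 21 (octic (21 ^+ 10) * l ^+ 2) < 0.
Proof.
move=> hl l_neq0; rewrite (moment_sqr _ _ hl).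
pose D p : R := moment 21 (octic (21 ^+ 10) * 'X_[mono (expo_add p p)]).
have -> : \sum_(p <- expos 1) \sum_(q <- expos 1) l@_(mono p) * l@_(mono q) *
      moment 21 (octic (21 ^+ 10) * 'X_[mono (expo_add p q)]) =
    \sum_(p <- expos 1) l@_(mono p) ^+ 2 * D p.
  rewrite big_seq [RHS]big_seq; apply: eq_bigr => p p_in.
  rewrite (bigD1_seq p) ?uniq_expos //= big1_seq ?addr0 ?expr2 // => q.
  by case/andP=> neq q_in; rewrite octic_moment_offdiag ?mulr0 // eq_sym.
have D_lt0 p : p \in expos 1 -> D p < 0 by apply: octic_moment_diag.
have [p p_in lp] : exists2 p, p \in expos 1 & l@_(mono p) != 0.
  apply/hasP; apply: contraNT l_neq0 => /hasPn l0.
  rewrite (homog_expansion hl) big1_seq // => p /andP[_ /l0].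
  by rewrite negbK => /eqP ->; rewrite scale0r.
have rest_le0 : \sum_(q <- expos 1 | q != p) l@_(mono q) ^+ 2 * D q <= 0.
  rewrite big_seq_cond; apply: sumr_le0 => q /andP[q_in _].
  by rewrite mulr_ge0_le0 ?sqr_ge0 // ltW ?D_lt0.
have head_lt0 : l@_(mono p) ^+ 2 * D p < 0.
  by rewrite pmulr_rlt0 ?D_lt0 // exprn_even_gt0.
by rewrite (bigD1_seq p) ?uniq_expos //=; lra.
Qed.

Theorem mainTheorem3 (R : realType) :
  exists f : {mpoly R[3]}, nonneg_form 4 f /\
    forall g : {mpoly R[3]}, g != 0 -> sos_form 1 g -> ~ sos_form 5 (f * g).
Proof.
exists (octic (21 ^+ 10)); split; first by apply: octic_nonneg; rewrite exprn_ge0.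
move=> g g_neq0 [u u_lin g_eq] [v v_quint fg_eq].
have u_neq0 : has (fun l => l != 0) u.
  apply: contraNT g_neq0 => /hasPn u0; rewrite g_eq big1_seq // => l /andP[_ /u0].
  by rewrite negbK => /eqP ->; rewrite expr2 mul0r.
have moment_g : moment 21 (octic (21 ^+ 10) * g) < 0 :> R.
  rewrite g_eq (bigID (fun l => l == 0)) /= big1 ?add0r; last first.
    by move=> l /eqP ->; rewrite expr2 mul0r.
  rewrite -big_filter mulr_sumr.
  under eq_bigr => l _ do rewrite -[_ * _]scale1r.
  rewrite moment_comb.
  set w := [seq l <- u | _].
  have w_lt0 l : l \in w -> 1 * moment 21 (octic (21 ^+ 10) * l ^+ 2) < 0 :> R.
    rewrite mem_filter => /andP[l0 l_in].
    by rewrite mul1r octic_moment_sqr_lt0 ?u_lin.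
  have has_w : has (mem w) w.
    have /hasP[l l_in l0] := u_neq0.
    by apply/hasP; exists l; rewrite /= mem_filter l0 l_in.
  by have := ltr_sum has_w w_lt0; rewrite big1_eq -big_seq.
have : 0 <= moment 21 (octic (21 ^+ 10) * g) :> R; last by rewrite leNgt moment_g.
rewrite fg_eq; under eq_bigr => h _ do rewrite -[h ^+ 2]scale1r.
rewrite moment_comb big_seq; apply: sumr_ge0 => h h_in.
by rewrite mul1r moment_sqr_ge0 // v_quint.
Qed.
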